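(* Let $\mathcal{H}$ be a separable Hilbert space and let $T\in GL(\mathcal{H})$. If $\{f_n\}_{n\in\mathbb{Z}}=\{T^nf_0\}_{n\in\mathbb{Z}}$ is a tight frame of $\mathcal{H}$, then $T$ is unitary.
   Context: A sequence $\{f_n\}_{n\in\mathbb{Z}}$ in a (complex) separable Hilbert space $\mathcal{H}$ is a frame if there exist $A,B>0$ with $A\|f\|^2\le\sum_{n\in\mathbb{Z}}|\langle f,f_n\rangle|^2\le B\|f\|^2$ for all $f\in\mathcal{H}$; it is tight if one can take $A=B$. $GL(\mathcal{H})$ is the set of bounded linear bijective operators $T:\mathcal{H}\to\mathcal{H}$ (hence with bounded inverse). The equality $\{f_n\}_{n\in\mathbb{Z}}=\{T^nf_0\}_{n\in\mathbb{Z}}$ means $f_n=T^nf_0$ for all $n\in\mathbb{Z}$. *)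

(* Defs.v *)
From HB Require Import structures.
From mathcomp Require Import all_boot all_order all_algebra complex.
From mathcomp Require Import all_classical all_reals all_analysis.

Set Implicit Arguments.
Unset Strict Implicit.
Unset Printing Implicit Defensive.

Import Order.TTheory GRing.Theory Num.Theory.
Import numFieldNormedType.Exports.

Local Open Scope classical_set_scope.
Local Open Scope ring_scope.

(* The type of [inner] makes it linear in its first argument, conjugate-linear
   in the second, conjugate-symmetric and positive definite. *)
HB.mixin Record isHilbert (R : realType) H of @CompleteNormedModule R[i] H := {
  inner : {dot H for Num.conj};
  sqr_norm_inner : forall x : H, `|x| ^+ 2 = inner x x
}.

#[short(type="hilbertType")]
HB.structure Definition Hilbert (R : realType) :=
  {H of isHilbert R H & @CompleteNormedModule R[i] H}.

Definition separable_space (H : topologicalType) : Prop :=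
  exists2 D : set H, countable D & dense D.

Section Defs.
Variables (R : realType) (H : hilbertType R).

(* Norms over R[i] are R[i]-valued (with zero imaginary part); their real part
   loses no information. *)
Definition frame_bounds (A B : R) (u : int -> H) : Prop :=
  forall f : H,
    ((A * complex.Re `|f| ^+ 2)%:E
       <= \esum_(n in [set: int]) (complex.Re `|inner f (u n)| ^+ 2)%:E)%E /\
    (\esum_(n in [set: int]) (complex.Re `|inner f (u n)| ^+ 2)%:E
       <= (B * complex.Re `|f| ^+ 2)%:E)%E.

Definition frame (u : int -> H) : Prop :=
  exists A B : R, [/\ 0 < A, 0 < B & frame_bounds A B u].

Definition tight_frame (u : int -> H) : Prop :=
  frame u /\ exists2 A : R, 0 < A & frame_bounds A A u.

Definition bounded_operator (T : {linear H -> H}) : Prop :=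
  exists M : R, forall x : H, complex.Re `|T x| <= M * complex.Re `|x|.

Definition GL (T : {linear H -> H}) : Prop :=
  bounded_operator T /\ bijective T.

Definition adjoint_of (T S : {linear H -> H}) : Prop :=
  forall x y : H, inner (T x) y = inner x (S y).

(* T T^* = T^* T = 1. *)
Definition unitary (T : {linear H -> H}) : Prop :=
  bounded_operator T /\
  exists S : {linear H -> H},
    [/\ bounded_operator S, adjoint_of T S, cancel T S & cancel S T].

(* For bijective T, the partial inverse 'pinv_ is the inverse of T
   (see [opinvK] and [opinvKV]). *)
Definition opinv (T : H -> H) : H -> H := 'pinv_(fun=> 0) [set: H] T.

Definition opz (T : H -> H) (n : int) : H -> H :=
  match n with
  | Posz k => iter k T
  | Negz k => iter k.+1 (opinv T)
  end.

Lemma opinvK (T : H -> H) : bijective T -> cancel T (opinv T).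
Proof.
move=> /bij_inj Tinj x; rewrite /opinv pinvKV ?in_setT //.
by move=> y z _ _; exact: Tinj.
Qed.

Lemma opinvKV (T : H -> H) : bijective T -> cancel (opinv T) T.
Proof.
move=> [S TS ST] x; rewrite /opinv pinvK //.
by rewrite inE /=; exists (S x).
Qed.

End Defs.

(* Main.v *)
Require Import Defs.
From HB Require Import structures.
From mathcomp Require Import all_boot all_order all_algebra complex.
From mathcomp Require Import all_classical all_reals all_analysis.
From mathcomp Require Import ring.

(** Let A be the constant of the tight frame (f_n), write c_n = <y, f_n>, and
    recall that T shifts the frame: T f_n = f_{n+1}. Tightness reconstructs
    every vector, A y = sum_n c_n f_n, so formally

      A (T y) = sum_n c_n f_{n+1}.

    Any synthesis sum v = sum_n c_n g_n over a system with Bessel bound A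
    satisfies |v|^2 <= A sum_n |c_n|^2, and sum_n |c_n|^2 = A |y|^2, whence
    |A (T y)| <= A |y|: T is a contraction. The same computation with
    T^-1 f_n = f_{n-1} makes T^-1 a contraction, so T is a bijective isometry,
    and polarization gives <T x, y> = <x, T^-1 y>, that is T^* = T^-1.

    Two points make this rigorous. The reconstruction converges in norm
    because |A y - sum_F c_n f_n|^2 <= A (A |y|^2 - sum_F |c_n|^2) for every
    finite F ([reconstruction_bound]), which again follows from the synthesis
    bound. And an operator may be applied term by term as soon as its graph is
    closed, because the shifted series converges by completeness of H
    ([closed_graph_contraction]). T^-1 inherits a closed graph from T, so one
    lemma serves both operators, and the boundedness of T^-1 comes out as a
    conclusion of the argument. *)

Set Implicit Arguments.
Unset Strict Implicit.
Unset Printing Implicit Defensive.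

Import Order.TTheory GRing.Theory Num.Theory.
Import numFieldNormedType.Exports.

Local Open Scope classical_set_scope.
Local Open Scope ring_scope.

(** * Inner products and linear isometries *)

Section InnerProduct.
Variables (R : realType) (H : hilbertType R).
Implicit Types (x y : H) (c : R[i]).

Lemma innerC x y : inner y x = (inner x y)^*.
Proof. by rewrite hermC expr0 mul1r. Qed.

Lemma innerZr c x y : inner x (c *: y) = c^* * inner x y.
Proof. exact: linearZr. Qed.

Lemma sqr_normB_inner x y :
  `|x - y| ^+ 2 = `|x| ^+ 2 - (inner x y + inner y x) + `|y| ^+ 2.
Proof.
rewrite !sqr_norm_inner linearBl !linearBr /=; ring.
Qed.

(** Complex polarization: comparing |x - y|^2 with its image gives
    2 Re <x, y>, and doing so for ['i *: y] as well gives 2 Im <x, y>. *)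
Lemma isometry_inner (T : {linear H -> H}) :
  (forall x, `|T x| = `|x|) -> forall x y, inner (T x) (T y) = inner x y.
Proof.
move=> Tnorm x y.
have sum_eq u v : inner (T u) (T v) + inner (T v) (T u) = inner u v + inner v u.
  have := sqr_normB_inner (T u) (T v).
  by rewrite -linearB !Tnorm sqr_normB_inner => /addIr /addrI /oppr_inj.
have e1 := sum_eq x y.
have e2 := sum_eq x ('i *: y).
move: e2; rewrite linearZ_LR !innerZr !linearZl_LR /= conjCi => e2.
have : (2 * 'i) * inner (T x) (T y) = (2 * 'i) * inner x y :> R[i].
  transitivity ('i * (inner (T x) (T y) + inner (T y) (T x))
    - (- 'i * inner (T x) (T y) + 'i * inner (T y) (T x))); first by ring.
  by rewrite e1 e2; ring.
by apply: mulfI; rewrite mulf_neq0 ?neq0Ci ?pnatr_eq0.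
Qed.

End InnerProduct.

(** * Finite Bessel systems *)

Section Bessel.
Variables (R : realType) (H : hilbertType R) (a : R[i]).
Hypothesis a_gt0 : 0 < a.

(** With v the synthesized vector, expand 0 <= sum |a c_i - <v, g_i>|^2. Both
    cross sums equal |v|^2, and the last sum is at most a |v|^2 by hypothesis,
    so 0 <= a^2 sum |c_i|^2 - a |v|^2. *)
Lemma synthesis_bound (I : Type) (s : seq I) (g : I -> H) (c : I -> R[i]) :
  (forall x, \sum_(i <- s) `|inner x (g i)| ^+ 2 <= a * `|x| ^+ 2) ->
  `|\sum_(i <- s) c i *: g i| ^+ 2 <= a * \sum_(i <- s) `|c i| ^+ 2.
Proof.
set v := \sum_(i <- s) c i *: g i => bessel_s.
have a_real : a^* = a by apply: CrealP; rewrite realE ltW.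
have vE : `|v| ^+ 2 = \sum_(i <- s) c i * (inner v (g i))^*.
  rewrite sqr_norm_inner {1}/v linear_sumlz /=; apply: eq_bigr => i _.
  by rewrite linearZl_LR /= -innerC.
have vE' : `|v| ^+ 2 = \sum_(i <- s) (c i)^* * inner v (g i).
  rewrite sqr_norm_inner {2}/v linear_sumr /=; apply: eq_bigr => i _.
  exact: innerZr.
have : 0 <= \sum_(i <- s) `|a * c i - inner v (g i)| ^+ 2.
  by apply: sumr_ge0 => i _; rewrite exprn_ge0.
rewrite (eq_bigr (fun i => a ^+ 2 * `|c i| ^+ 2 - a * (c i * (inner v (g i))^*)
    - a * ((c i)^* * inner v (g i)) + `|inner v (g i)| ^+ 2)); last first.
  by move=> i _; rewrite !normCK rmorphB rmorphM /= a_real; ring.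
rewrite big_split /= !sumrB -!mulr_sumr -vE -vE' => ge0.
rewrite -subr_ge0 -(pmulr_rge0 _ a_gt0).
apply: (le_trans ge0); rewrite -subr_ge0.
have := bessel_s v; rewrite -subr_ge0; congr (0 <= _); ring.
Qed.

(** With v = sum <y, g_i> g_i, the cross terms of |a y - v|^2 are the sum S of
    the |<y, g_i>|^2, and the synthesis bound gives |v|^2 <= a S. Hence the
    reconstruction error is controlled by the defect in Parseval's identity. *)
Lemma reconstruction_bound (I : Type) (s : seq I) (g : I -> H) y :
  (forall x, \sum_(i <- s) `|inner x (g i)| ^+ 2 <= a * `|x| ^+ 2) ->
  `|a *: y - \sum_(i <- s) inner y (g i) *: g i| ^+ 2 <=
    a * (a * `|y| ^+ 2 - \sum_(i <- s) `|inner y (g i)| ^+ 2).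
Proof.
move=> bessel_s.
have a_real : a^* = a by apply: CrealP; rewrite realE ltW.
have /= := synthesis_bound (fun i => inner y (g i)) bessel_s.
set v := \sum_(i <- s) _; set S := \sum_(i <- s) _ => v_le.
have vyE : inner v y = S.
  rewrite /v linear_sumlz /=; apply: eq_bigr => i _.
  by rewrite linearZl_LR /= normCK -innerC.
have S_real : S^* = S.
  by apply: CrealP; rewrite realE sumr_ge0// => i _; rewrite exprn_ge0.
rewrite sqr_normB_inner normrZ linearZl_LR /= innerZr a_real vyE.
rewrite innerC vyE S_real (gtr0_norm a_gt0) -subr_ge0.
move: v_le; rewrite -subr_ge0; congr (0 <= _); ring.
Qed.

End Bessel.

(** * Parseval systems and closed operators *)

Section Parseval.
Variables (R : realType) (H : hilbertType R) (a : R[i]).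
Hypothesis a_gt0 : 0 < a.

(** Values are complex so that they can be compared directly with the norms of
    [H]; [R[i]^o] is the normed space that gives the limit its meaning. *)
Definition parseval (g : nat -> H) : Prop :=
  forall x, (series (fun i => `|inner x (g i)| ^+ 2) : nat -> R[i]^o) @ \oo -->
    (a * `|x| ^+ 2 : R[i]^o).

Lemma parseval_bessel (g : nat -> H) : parseval g -> forall m n x,
  \sum_(m <= i < n) `|inner x (g i)| ^+ 2 <= a * `|x| ^+ 2.
Proof.
move=> gP m n x; pose u i := `|inner x (g i)| ^+ 2.
have u_ge0 i : 0 <= u i by rewrite exprn_ge0.
have sum_le p q r : (r <= p)%N ->
    \sum_(p <= i < q) u i <= \sum_(r <= i < q) u i.
  move=> rp; have [pq|qp] := leqP p q.
    by rewrite (big_cat_nat rp pq)/= lerDr sumr_ge0.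
  by rewrite (big_geq (ltnW qp)) sumr_ge0.
apply: (le_trans (sum_le _ _ _ (leq0n m))); apply/ler_addgt0Pl => e e0.
have /cvgrPdist_le/(_ e e0)[N _ Nle] := gP x.
have /= := Nle (maxn N n) (leq_maxl _ _).
set s := series _ _ => dist_le.
have s_real : s \is Num.real by rewrite realE sumr_ge0.
have l_real : a * `|x| ^+ 2 \is Num.real.
  by rewrite realE mulr_ge0 ?(ltW a_gt0) ?exprn_ge0.
have : s <= e + a * `|x| ^+ 2.
  rewrite -lerBlDr; apply: le_trans dist_le.
  by rewrite distrC real_ler_norm// rpredB.
apply: le_trans; rewrite /s /series /= (@big_cat_nat _ _ _ n 0 (maxn N n))//=.
  by rewrite lerDl sumr_ge0.
exact: leq_maxr.
Qed.

Definition closed_graph (U : H -> H) : Prop :=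
  forall (u : nat -> H) x y, u @ \oo --> x -> (U \o u) @ \oo --> y -> U x = y.

Lemma parseval_reconstruction (g : nat -> H) y : parseval g ->
  series (fun i => inner y (g i) *: g i) @ \oo --> a *: y.
Proof.
move=> gP; apply/cvgrPdist_lt => e e0.
have d0 : 0 < e ^+ 2 / a by rewrite divr_gt0 ?exprn_gt0.
have /cvgrPdist_lt/(_ _ d0) := gP y; apply: filterS => n /= dist_lt.
rewrite -(@ltr_pXn2r _ 2)// ?nnegrE ?(ltW e0)//.
apply: le_lt_trans (reconstruction_bound a_gt0 y _) _.
  by move=> x; exact: parseval_bessel.
rewrite mulrC -ltr_pdivlMr//; apply: le_lt_trans dist_lt.
have s_ge0 : 0 <= series (fun i => `|inner y (g i)| ^+ 2) n.
  by rewrite sumr_ge0// => i _; rewrite exprn_ge0.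
by rewrite real_ler_norm// rpredB// ger0_real// mulr_ge0 ?(ltW a_gt0) ?exprn_ge0.
Qed.

(** The series of the <y, g_i> g'_i is Cauchy because, by the synthesis bound
    for [g'], its blocks are dominated by blocks of the convergent series of
    the |<y, g_i>|^2. Its partial sums are the images under [U] of the partial
    sums that reconstruct a y, so the closed graph makes U (a y) its limit, and
    the synthesis bound passes to the limit. *)
Lemma closed_graph_contraction (g g' : nat -> H) (U : {linear H -> H}) :
  closed_graph U -> parseval g -> parseval g' -> (forall i, U (g i) = g' i) ->
  forall y, `|U y| <= `|y|.
Proof.
move=> Ucl gP g'P Ug y.
pose Z := series (fun i => inner y (g i) *: g' i).
have Z_le m n : `|\sum_(m <= i < n) inner y (g i) *: g' i| ^+ 2 <=
    a * \sum_(m <= i < n) `|inner y (g i)| ^+ 2.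
  by apply: synthesis_bound => // x; exact: parseval_bessel.
have Z_cvg : cvg (Z @ \oo).
  apply/cauchy_cvgP/cauchy_seriesP => e e0.
  have d0 : 0 < e ^+ 2 / a by rewrite divr_gt0 ?exprn_gt0.
  have /cvgP/cvg_cauchy/cauchy_seriesP/(_ _ d0) := gP y.
  apply: filterS => -[m n] /= sum_lt.
  rewrite -(@ltr_pXn2r _ 2)// ?nnegrE ?(ltW e0)//.
  apply: le_lt_trans (Z_le m n) _; rewrite mulrC -ltr_pdivlMr//.
  by rewrite ger0_norm// in sum_lt; rewrite sumr_ge0// => i _; rewrite exprn_ge0.
have UayE : U (a *: y) = lim (Z @ \oo).
  apply: (Ucl _ _ _ (parseval_reconstruction (y := y) gP)).
  suff -> : U \o series (fun i => inner y (g i) *: g i) = Z by [].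
  apply/funext => n /=; rewrite /Z /series /= linear_sum.
  by apply: eq_bigr => i _; rewrite linearZ Ug.
rewrite -(ler_pM2l a_gt0) -{1}(gtr0_norm a_gt0) -normrZ -linearZ UayE.
apply/ler_addgt0Pl => e e0.
have /cvgrPdist_le/(_ e e0)[N _ /(_ N (leqnn N)) /= dist_le] := Z_cvg.
rewrite -[X in `|X|](subrK (Z N)).
apply: le_trans (ler_normD _ _) (lerD dist_le _).
rewrite -(@ler_pXn2r _ 2)// ?nnegrE ?mulr_ge0 ?(ltW a_gt0)//.
apply: le_trans (Z_le _ _) _; rewrite exprMn expr2 -mulrA ler_pM2l//.
exact: parseval_bessel.
Qed.

End Parseval.

(** * Frames generated by the powers of an operator *)

Definition int_enum (n : nat) : int := if odd n then Negz n./2 else Posz n./2.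

Lemma int_enum_bij : bijective int_enum.
Proof.
exists (fun n : int => match n with Posz k => k.*2 | Negz k => k.*2.+1 end).
- move=> n; rewrite /int_enum -[RHS]odd_double_half.
  by case: (odd n).
- by case=> k; rewrite /int_enum /= odd_double ?doubleK ?uphalf_double.
Qed.

Section OperatorOrbits.
Variables (R : realType) (H : hilbertType R).
Local Open Scope complex_scope.

(** The sum defining a frame is unordered and may be reindexed by any
    enumeration. The enumerations n |-> [int_enum n] + k are used below: they
    make the k-th shift of a frame indexed by the integers a Parseval system
    as well. *)
Lemma tight_frame_parseval (A : R) (u : int -> H) (e : nat -> int) :
  bijective e -> frame_bounds A A u -> parseval A%:C (u \o e).
Proof.
rewrite -setTT_bijective => ebij uA x.
have sqr_norm_Re (V : normedZmodType R[i]) (v : V) :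
    (complex.Re `|v| ^+ 2)%:C = `|v| ^+ 2.
  by rewrite rmorphXn /= RRe_real// normr_real.
pose t n := complex.Re `|inner x ((u \o e) n)| ^+ 2.
have t_ge0 n : (0 <= (t n)%:E)%E by rewrite lee_fin sqr_ge0.
have : (\sum_(0 <= i < n) (t i)%:E)%E @[n --> \oo] -->
    (A * complex.Re `|x| ^+ 2)%:E.
  have <- : (\sum_(0 <= i <oo) (t i)%:E)%E = (A * complex.Re `|x| ^+ 2)%:E.
    have [lb ub] := uA x.
    apply/eqP; rewrite nneseries_esumT// eq_le; move: lb ub.
    by rewrite (reindex_esum _ _ _ _ ebij) => -> ->.
  exact: is_cvg_nneseries.
move=> /fine_cvgP[_ /cvgrPdist_lt tcvg].
apply/cvgrPdist_lt => d d0.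
have dE : (complex.Re d)%:C = d by rewrite RRe_real// gtr0_real.
have : 0 < complex.Re d by rewrite -ltcR dE.
move=> /tcvg; apply: filterS => n /=.
rewrite sumEFin /= -ltcR dE; apply: le_lt_trans.
have -> : A%:C * `|x| ^+ 2 = (A * complex.Re `|x| ^+ 2)%:C.
  by rewrite rmorphM /= sqr_norm_Re.
have -> : series (fun i => `|inner x ((u \o e) i)| ^+ 2) n =
    (\sum_(0 <= i < n) t i)%:C.
  by rewrite /series /= rmorph_sum; apply: eq_bigr => i _; rewrite -sqr_norm_Re.
by rewrite -rmorphB normc_def /= expr0n addr0 sqrtr_sqr.
Qed.

Lemma opz_succ (T : H -> H) (n : int) x : bijective T ->
  opz T (n + 1) x = T (opz T n x).
Proof.
move=> Tbij; case: n => [k|[|k]].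
- by rewrite -PoszD addn1.
- by rewrite /= opinvKV.
- have -> : Negz k.+1 + 1 = Negz k by rewrite !NegzE -addn1 PoszD; ring.
  by rewrite [in RHS]/= opinvKV.
Qed.

Lemma bounded_operator_closed_graph (T : {linear H -> H}) :
  bounded_operator T -> closed_graph T.
Proof.
move=> [M TM] u x y ux uy.
have Tcont : continuous T.
  apply/linear_bounded_continuous/linear_boundedP.
  exists M%:C; split; first by apply/complex_realP; exists M.
  move=> r Mr v; apply: (@le_trans _ _ (M%:C * `|v|)).
    have := TM v; rewrite -lecR rmorphM /= !RRe_real//; exact: normr_real.
  by rewrite ler_wpM2r// ltW.
have Tux : T (u n) @[n --> \oo] --> T x by exact: (cvg_comp u T ux (Tcont x)).
exact: (cvg_unique (@norm_hausdorff _ _) Tux uy).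
Qed.

End OperatorOrbits.

Theorem corollary2p3 (R : realType) (H : hilbertType R)
    (Hsep : separable_space H) (T : {linear H -> H}) (HT : GL T)
    (f : int -> H) (Hf : forall n : int, f n = opz T n (f 0%R))
    (Htight : tight_frame f) :
  unitary T.
Proof.
have [Tbd Tbij] := HT; have [_ [A A0 fA]] := Htight.
have TK := opinvK Tbij; have KT := opinvKV Tbij.
have Slin : linear (opinv T) := can2_linear TK KT.
pose S : {linear H -> H} :=
  HB.pack (opinv T) (GRing.isLinear.Build _ _ _ _ (opinv T) Slin).
have Tf n : T (f n) = f (n + 1) by rewrite (Hf (n + 1)) opz_succ// -Hf.
have Tcl := bounded_operator_closed_graph Tbd.
(* The graph of the inverse is the graph of T with the factors exchanged. *)
have Scl : closed_graph S.
  move=> u x y ux Suy; rewrite -[y]TK; congr (opinv T _).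
  apply/esym; apply: (Tcl (S \o u) y x Suy).
  by have -> : T \o (S \o u) = u by apply/funext => n /=; exact: KT.
have AC0 : 0 < (A%:C)%C by rewrite ltcR.
have shift_bij (k : int) : bijective (fun n => int_enum n + k).
  apply: (@bij_comp _ _ _ (+%R^~ k) _ _ int_enum_bij).
  by exists (fun n => n - k) => n; rewrite ?addrK ?subrK.
have f_parseval k := tight_frame_parseval (shift_bij k) fA.
have T_le : forall y, `|T y| <= `|y|.
  apply: (closed_graph_contraction AC0 Tcl (f_parseval 0) (f_parseval 1)) => i.
  by rewrite /= addr0 Tf.
have S_le : forall y, `|S y| <= `|y|.
  apply: (closed_graph_contraction AC0 Scl (f_parseval 1) (f_parseval 0)) => i.
  by rewrite /= addr0 -Tf; exact: TK.
have T_isom x : `|T x| = `|x|.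
  apply/eqP; rewrite eq_le T_le /= -{1}[x]TK; exact: S_le.
split=> //; exists S; split=> //.
- by exists 1 => x; rewrite mul1r -lecR !RRe_real ?normr_real.
- by move=> x y; rewrite -{1}[y]KT; exact: isometry_inner.
Qed.
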